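(* Suppose $x_{max}\ge\max[a_{max},\epsilon]$. Suppose $Q(0)=Z(0)=0$ and that for all $t\in\{0,1,2,\ldots\}$ the decision $x(t)$ is made by the threshold algorithm $$x(t)=\begin{cases}0 & \text{if } Q(t)+Z(t)\le V\gamma(t),\\ x_{max} & \text{otherwise,}\end{cases}$$ with fixed parameters $\epsilon\ge 0$ and $V>0$, where $Q$ and $Z$ evolve by $$Q(t+1)=\max[Q(t)-s(t)-x(t),0]+a(t),$$ $$Z(t+1)=\max[Z(t)-s(t)-x(t)+\epsilon 1_{\{Q(t)>0\}},0].$$ Then: (a) For every slot $t$, $Q(t)\le Q_{max}$ and $Z(t)\le Z_{max}$, where $Q_{max}=V\gamma_{max}+a_{max}$ and $Z_{max}=V\gamma_{max}+\epsilon$. (b) The worst case delay of any request is $D_{max}=\left\lceil (2V\gamma_{max}+a_{max}+\epsilon)/\epsilon\right\rceil$, i.e. every request is fulfilled with delay at most $D_{max}$ slots (for $\epsilon=0$ one reads $D_{max}=\infty$, so that no assertion is made). (c) If the vector $(s(t),a(t),\gamma(t))$ is i.i.d. over slots, and if $\epsilon\le\max[\mathbb{E}\{a(t)\},\mathbb{E}\{s(t)\}]$, then for all slots $t>0$ $$\frac1t\sum_{\tau=0}^{t-1}\mathbb{E}\{\gamma(\tau)\tilde x(\tau)\}\le\frac1t\sum_{\tau=0}^{t-1}\mathbb{E}\{\gamma(\tau)x(\tau)\}\le c^*+B/V,$$ where $$B=\frac{(s_{max}+x_{max})^2+a_{max}^2}{2}+\frac{\max[\epsilon^2,(s_{ma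x}+x_{max})^2]}{2}.$$
   Context: Time is slotted, $t\in\{0,1,2,\ldots\}$. The processes $s(t)$ (renewable supply), $a(t)$ (energy requests arriving on slot $t$) and $\gamma(t)$ (per-unit price of outside energy) are real-valued stochastic processes with $0\le s(t)\le s_{max}$, $0\le a(t)\le a_{max}$, $0\le\gamma(t)\le\gamma_{max}$ for all $t$, for finite constants $s_{max},a_{max},\gamma_{max}$. Every slot a controller chooses $x(t)$ (energy requested from an outside source) with $0\le x(t)\le x_{max}$, where $x_{max}$ is a finite constant. $Q(t)\ge0$ is the queue of unserved energy requests and $Z(t)\ge 0$ is a virtual queue; $1_{\{Q(t)>0\}}$ is $1$ if $Q(t)>0$ and $0$ otherwise. Delay: service is First-In-First-Out. Requests $a(t)$ are first available for service on slot $t+1$ and are part of the backlog $Q(t+1)$. On slot $\tau$ the amount of energy requests served is $\min[Q(\tau),s(\tau)+x(\tau)]$. The requests $a(t)$ are fulfilled with delay at most $D$ slots if they are served on or before slot $t+D$, i.e. $\sum_{\tau=t+1}^{t+D}\min[Q(\tau),s(\tau)+x(\tau)]\ge Q(t+1)$. Actual purchase: $\tilde x(t)=x(t)$ if $Q(t)-s(t)\ge x(t)$, and $\tilde x(t)=\max[Q(t)-s(t),0]$ otherwise. Optimal cost (i.i.d. case): $c^*$ is the infimum, over all possible ways of choosing $x(t)$ over time (possibly randomized), of the time average cost $\overline c=\lim_{t\to\infty}\frac1t\sum_{\tau=0}^{t-1}\mathbb{E}\{\gamma(\tau)x(\tau)\}$ (for policies for which this limit is well defined) subject to $\overline Q=\limsup_{t\to\infty}\frac1t\sum_{\tau=0}^{t-1}\mathbb{E}\{Q(\tau)\}<\infty$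 and $0\le x(t)\le x_{max}$ for all $t$, where $Q$ evolves by $Q(t+1)=\max[Q(t)-s(t)-x(t),0]+a(t)$. *)

(* Defs.v *)
From HB Require Import structures.
From mathcomp Require Export all_boot all_order all_algebra.
From mathcomp Require Export all_classical all_reals all_analysis.

Set Implicit Arguments.
Unset Strict Implicit.
Unset Printing Implicit Defensive.
Import Order.TTheory GRing.Theory Num.Theory.
Import numFieldNormedType.Exports.

Local Open Scope classical_set_scope.
Local Open Scope ring_scope.

Section SamplePath.
Context {R : realType}.
Implicit Types (s a x Q : nat -> R) (q t D : nat).

Fixpoint backlog s a x t : R :=
  if t is u.+1 then Num.max (backlog s a x u - s u - x u) 0 + a u else 0.

(* First-In-First-Out service: the requests [a t], which are last in the line
   of length [Q t.+1], are served by slot [t + D] iff that much energy has been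
   served on the slots [t + 1, ..., t + D]. *)
Definition fulfilled_within s x Q t D : Prop :=
  Q t.+1 <= \sum_(t.+1 <= tau < (t + D).+1) Num.min (Q tau) (s tau + x tau).

Definition actual_purchase (Qt st xt : R) : R :=
  if xt <= Qt - st then xt else Num.max (Qt - st) 0.

End SamplePath.

Section Stochastic.
Context {R : realType} {d : measure_display} {Omega : measurableType d}.
Variable P : probability Omega R.

(* The bigcap over [::] is setT, so J = [::] is the trivial instance. *)
Definition iid {d' : measure_display} {E : measurableType d'}
    (X : nat -> Omega -> E) : Prop :=
  (forall (t : nat) (A : set E), measurable A ->
     P (X t @^-1` A) = P (X 0%N @^-1` A)) /\
  (forall (J : seq nat) (A : nat -> set E), uniq J ->
     (forall t, measurable (A t)) ->
     P (\bigcap_(t in [set` J]) (X t @^-1` A t)) =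
     (\prod_(t <- J) P (X t @^-1` A t))%E).

Definition time_average (X : nat -> Omega -> R) (t : nat) : \bar R :=
  ((t%:R^-1)%:E * \sum_(0 <= tau < t) 'E_P[X tau])%E.

End Stochastic.

Section OptimalCost.
Context {R : realType} {d : measure_display} {Omega : measurableType d}.
Variables (P : probability Omega R) (s a gamma : nat -> Omega -> R).
Variable x_max : R.

(* A policy is any family of decisions in [0, x_max] depending measurably on the
   environment and on an independent random seed u : U.  No causality is
   required, so policies knowing the future are competitors as well. *)
Definition attainable_costs : set (\bar R) :=
  [set c | exists (d' : measure_display) (U : measurableType d')
             (PU : probability U R) (x : nat -> {RV (P \x PU)%E >-> R}),
    [/\ forall t w, 0 <= x t w <= x_max,
        (limn_esup (time_average (P \x PU)%E (fun t w =>
           backlog (s^~ w.1) (a^~ w.1) (x^~ w) t)) < +oo)%E &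
        time_average (P \x PU)%E (fun t w => gamma t w.1 * x t w)
          @ \oo --> c]].

Definition optimal_cost : \bar R := ereal_inf attainable_costs.

End OptimalCost.

(* Main.v *)
Require Import Defs.
From mathcomp Require Import measurable_realfun ring lra.

Set Implicit Arguments.
Unset Strict Implicit.
Unset Printing Implicit Defensive.
Import Order.TTheory GRing.Theory Num.Theory.
Import numFieldNormedType.Exports.

Local Open Scope classical_set_scope.
Local Open Scope ring_scope.

(** The queue bounds hold because the algorithm buys [x_max], which is at
    least [a_max] and at least [eps], whenever [Q] or [Z] exceeds
    [V * gamma_max].  A queue above this level loses on a slot at least what
    it can gain, unless it is emptied; a queue below it can pass it by the
    input of one slot only ([backlogs_bounded]).  The delay bound uses [Z] as
    a clock.  While a request waits, the queue is not empty and all the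
    energy offered goes to requests ahead of it or to itself, so after [D]
    slots [Z] has received [D * eps] and lost less than [Q_max].  As [Z] is
    at most [Z_max], this forces [D * eps < Q_max + Z_max] ([delay_bounded]).

    The cost bound is a Lyapunov drift argument with
    [L = (Q ^+ 2 + Z ^+ 2) / 2].  The threshold rule minimizes
    [(V * gamma - Q - Z) * y] over [y] in [0, x_max], so the increment of [L]
    plus [V * gamma * x] is at most [B] plus [drift_bound], the minimum over
    [y] of [Q * (a - s - y) + Z * (eps - s - y) + V * gamma * y]
    ([drift_plus_penalty]).  After taking expectations and telescoping, what
    remains is that the mean of [drift_bound] is at most [V * c] for every
    attainable cost [c].  This has two parts.

    First, [Q t] and [Z t] are functions of the environment before slot [t],
    hence independent of the environment on slot [t].  By Fubini it is enough
    to bound the mean of [drift_bound] for constant queue lengths [q] and [z]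
    ([drift_bound_expectation_le]).

    Second, fix [q, z >= 0] and a competitor with decisions [x' tau] and
    backlog [Q' tau].  Its decision on slot [tau], whatever it depends on, is
    one of the [y] in the minimum, so the mean [G] of [drift_bound], which is
    the same on all slots, is at most [q * E (a - s - x' tau) + z * E (eps -
    s - x' tau) + V * E (gamma * x' tau)].  Summing over [tau < n], the
    coefficient of [q] is at most [E (Q' n)], since a queue is at least its
    arrivals minus the service offered; so is the coefficient of [z], because
    [eps] is at most [E a] or at most [E s].  Thus
    [G <= (q + z) * E (Q' n) / n + V * C n], where [C n] is the average cost
    of the competitor over [n] slots.  A bounded time average of [E (Q' n)]
    does not force [E (Q' n) / n] to converge to 0, but it makes this
    quotient arbitrarily small for arbitrarily large [n]
    ([sublinear_frequently]), and this gives [G <= V * c]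
    ([drift_bound_le_attainable]). *)

(** * Queue and delay bounds on a sample path *)

Section SamplePathBounds.
Variables (R : realType) (s a gamma x Q Z : nat -> R).
Variables (s_max a_max gamma_max x_max eps V : R).
Hypothesis hs : forall t, 0 <= s t <= s_max.
Hypothesis ha : forall t, 0 <= a t <= a_max.
Hypothesis hgamma : forall t, 0 <= gamma t <= gamma_max.
Hypothesis a_le_x : a_max <= x_max.
Hypothesis eps_le_x : eps <= x_max.
Hypothesis heps : 0 <= eps.
Hypothesis hV : 0 < V.
Hypothesis hQ0 : Q 0%N = 0.
Hypothesis hZ0 : Z 0%N = 0.
Hypothesis hx : forall t,
  x t = if Q t + Z t <= V * gamma t then 0 else x_max.
Hypothesis hQ : forall t, Q t.+1 = Num.max (Q t - s t - x t) 0 + a t.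
Hypothesis hZ : forall t, Z t.+1 =
  Num.max (Z t - s t - x t + (if 0 < Q t then eps else 0)) 0.

Lemma threshold_purchase_bounds t : 0 <= x t <= x_max.
Proof.
have x0 : 0 <= x_max by exact: le_trans heps eps_le_x.
by rewrite hx; case: ifP => _; rewrite lexx ?x0.
Qed.

Lemma backlogs_ge0 t : 0 <= Q t /\ 0 <= Z t.
Proof.
case: t => [|t]; first by rewrite hQ0 hZ0.
rewrite hQ hZ; split; last by rewrite le_max lexx orbT.
by rewrite addr_ge0 ?le_max ?lexx ?orbT //; case/andP: (ha t).
Qed.

Lemma backlogs_bounded t :
  Q t <= V * gamma_max + a_max /\ Z t <= V * gamma_max + eps.
Proof.
move: (heps) (eps_le_x) (a_le_x) => e0 ex ax.
have Vg u : 0 <= V * gamma u <= V * gamma_max.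
  case/andP: (hgamma u) => g0 g1.
  by rewrite mulr_ge0 ?(ltW hV) //= ler_wpM2l // ltW.
elim: t => [|t [IHQ IHZ]].
  by rewrite hQ0 hZ0; have := Vg 0%N; have := ha 0%N; lra.
have [Q0 Z0] := backlogs_ge0 t.
have := Vg t; have := ha t; have := hs t; rewrite hQ hZ hx => st at_ gt.
by case: leP => QZ; (split; rewrite ?maxElt; do ! case: ifP => //); lra.
Qed.

(** If the requests of slot [t] were not served after [D] slots, then on each
    of these slots the queue would exceed the energy offered.  So the
    indicator in the recursion of [Z] would be 1 and the service subtracted
    from [Z] would be exactly the energy served. *)
Lemma delay_bounded t D :
  V * gamma_max + a_max + (V * gamma_max + eps) <= D%:R * eps ->
  fulfilled_within s x Q t D.
Proof.
move: (heps) => e0 hD; rewrite /fulfilled_within leNgt; apply/negP => unserved.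
pose m u := Num.min (Q u) (s u + x u).
pose S k := \sum_(t.+1 <= u < (t + k).+1) m u.
have m0 u : 0 <= m u.
  rewrite /m le_min; have [-> _] /= := backlogs_ge0 u.
  by have := hs u; have := threshold_purchase_bounds u; lra.
have SS k : S k.+1 = S k + m (t + k).+1.
  by rewrite /S addnS big_nat_recr //= ltnS leq_addr.
(* [S k] is the energy served during the first [k] slots of the window. *)
have SD k : (k <= D)%N -> S k < Q t.+1.
  move=> kD; apply: le_lt_trans unserved; rewrite -/(S D) -(subnKC kD).
  elim: (D - k)%N => [|i IH]; first by rewrite addn0.
  by rewrite addnS SS (le_trans IH) // lerDl.
suff [_] : Q t.+1 - S D <= Q (t + D).+1 /\ D%:R * eps - S D <= Z (t + D).+1.
  have [_] := backlogs_bounded (t + D).+1; have [+ _] := backlogs_bounded t.+1.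
  by have := SD D (leqnn _); lra.
have : (D <= D)%N by [].
elim: {-2}D => [_|k IH kD].
  rewrite /S addn0 big_geq //= mul0r !subr0 lexx.
  by have [] := backlogs_ge0 t.+1.
have [IHQ IHZ] := IH (ltnW kD).
have := SD _ kD; rewrite SS addnS (hQ (t + k).+1) hZ => lt_Q.
have := ha (t + k).+1; have := hs (t + k).+1.
have := threshold_purchase_bounds (t + k).+1.
move: lt_Q IHQ IHZ; move: (t + k).+1 => u.
rewrite /m -natr1 => + IHQ IHZ xu su au.
case: (leP (Q u) (s u + x u)) => Qb lt_Q; first lra.
have -> : 0 < Q u by lra.
rewrite !maxElt; split; case: ifP; lra.
Qed.

End SamplePathBounds.

(** * Drift plus penalty on one slot *)

(** The minimum over [y] in [0, x_max] of
    [q * (a - s - y) + z * (eps - s - y) + V * g * y], written in closed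
    form: the expression is affine in [y], so the minimum is at an end point. *)
Definition drift_bound {R : realType} (eps V x_max q z s a g : R) : R :=
  q * (a - s) + z * (eps - s) + Num.min ((V * g - q - z) * x_max) 0.

Section Drift.
Variables (R : realType).
Implicit Types eps V x_max q z s a g x y : R.

Lemma drift_bound_le eps V x_max q z s a g y : 0 <= y <= x_max ->
  drift_bound eps V x_max q z s a g <=
  q * (a - s - y) + z * (eps - s - y) + V * (g * y).
Proof.
move=> yx.
suff : Num.min ((V * g - q - z) * x_max) 0 <= (V * g - q - z) * y.
  by rewrite /drift_bound; lra.
have [c0|c0] := leP 0 (V * g - q - z).
  by rewrite ge_min mulr_ge0 ?orbT //; lra.
by rewrite ge_min ler_wnM2l //; lra.
Qed.

(** Squaring the recursions, after dropping the truncations at 0, leaves the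
    cross terms [q * (a - s - x)] and [z * (eps - s - x)] and squares bounded
    by the constants on the right.  The threshold rule picks the end point at
    which [drift_bound] is attained. *)
Lemma drift_plus_penalty eps V s_max a_max x_max q z s a g x q' z' :
  0 <= eps -> 0 <= x_max ->
  0 <= q -> 0 <= z -> 0 <= s <= s_max -> 0 <= a <= a_max ->
  x = (if q + z <= V * g then 0 else x_max) ->
  q' = Num.max (q - s - x) 0 + a ->
  z' = Num.max (z - s - x + (if 0 < q then eps else 0)) 0 ->
  (q' ^+ 2 + z' ^+ 2) / 2 - (q ^+ 2 + z ^+ 2) / 2 + V * (g * x) <=
  ((s_max + x_max) ^+ 2 + a_max ^+ 2) / 2 +
    Num.max (eps ^+ 2) ((s_max + x_max) ^+ 2) / 2 +
    drift_bound eps V x_max q z s a g.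
Proof.
move=> e0 xm0 q0 z0 ss aa xE -> ->.
(* The threshold decision attains the minimum defining [drift_bound]. *)
have dE : drift_bound eps V x_max q z s a g =
    q * (a - s - x) + z * (eps - s - x) + V * (g * x).
  rewrite /drift_bound xE; case: leP => h.
    by rewrite (min_idPr _) ?mulr_ge0 //; lra.
  by rewrite (min_idPl _) ?mulr_le0_ge0 //; lra.
have xx : 0 <= x <= x_max by rewrite xE; case: ifP => _; rewrite lexx ?xm0.
rewrite {}dE {xE}.
set q1 := Num.max _ 0 + a.
set e := if _ then _ else _; set z1 := Num.max _ 0.
have ee : 0 <= e <= eps by rewrite /e; case: ifP => _; rewrite lexx ?e0.
clearbody e.
have q'le : q1 ^+ 2 <= q ^+ 2 + a ^+ 2 + (s + x) ^+ 2 + 2 * q * (a - s - x).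
  have := sqr_ge0 (q - s - x).
  have : 0 <= (s + x) * a by apply: mulr_ge0; lra.
  have : 0 <= q * a by apply: mulr_ge0; lra.
  by rewrite /q1; case: (leP (q - s - x) 0) => h; rewrite !expr2; lra.
have z'le : z1 ^+ 2 <= z ^+ 2 + 2 * z * (eps - s - x) +
    Num.max (eps ^+ 2) ((s_max + x_max) ^+ 2).
  have : z1 ^+ 2 <= (z - s - x + e) ^+ 2.
    rewrite /z1; case: (leP (z - s - x + e) 0) => h; rewrite ?lexx //.
    by rewrite expr0n /= sqr_ge0.
  have : (e - s - x) ^+ 2 <= Num.max (eps ^+ 2) ((s_max + x_max) ^+ 2).
    rewrite le_max; have [h|h] := leP (s + x) e.
      by apply/orP; left; nra.
    by apply/orP; right; nra.
  have : z * (e - s - x) <= z * (eps - s - x) by apply: ler_wpM2l => //; lra.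
  lra.
have a2 : a ^+ 2 <= a_max ^+ 2 by nra.
have b2 : (s + x) ^+ 2 <= (s_max + x_max) ^+ 2 by nra.
lra.
Qed.

End Drift.

Section DriftBounds.
Variable R : realType.

Lemma mulr_bounds (x y mx my : R) :
  0 <= x <= mx -> 0 <= y <= my -> 0 <= x * y <= mx * my.
Proof. by move=> /andP[? ?] /andP[? ?]; rewrite mulr_ge0 //= ler_pM. Qed.

Lemma drift_bound_bounded (eps V s_max a_max g_max x_max qm zm q z s a g : R) :
  0 <= eps -> 0 < V -> 0 <= x_max ->
  0 <= q <= qm -> 0 <= z <= zm ->
  0 <= s <= s_max -> 0 <= a <= a_max -> 0 <= g <= g_max ->
  - ((qm + zm) * (s_max + x_max)) <= drift_bound eps V x_max q z s a g <=
  qm * a_max + zm * eps.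
Proof.
move=> e0 V0 x0 qq zz ss aa gg.
have xx : 0 <= x_max <= x_max by rewrite x0 lexx.
have ee : 0 <= eps <= eps by rewrite e0 lexx.
have qa := mulr_bounds qq aa; have qs := mulr_bounds qq ss.
have zs := mulr_bounds zz ss; have ze := mulr_bounds zz ee.
have qx := mulr_bounds qq xx; have zx := mulr_bounds zz xx.
have Vgx : 0 <= V * g * x_max.
  by rewrite !mulr_ge0 // ?(ltW V0) //; case/andP: gg.
rewrite /drift_bound; case: (leP ((V * g - q - z) * x_max) 0) => h;
  by apply/andP; split; lra.
Qed.

(** When the bounds on [G] are summed over the slots, the coefficient of [q]
    is at most the telescoping sum of the increments of [b].  So is the
    coefficient of [z] if [eps <= A]; if [eps <= S], it is at most 0.  Here
    [A] and [S] stand for the mean arrivals and supply, and [X t], [C t],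
    [b t] for the mean purchase, cost and backlog of a competitor. *)
Lemma competitor_sum_bound (G A S q z eps V : R) (X C b : nat -> R) n :
  0 <= q -> 0 <= z -> (eps <= A) || (eps <= S) ->
  (forall t, 0 <= X t) -> (forall t, 0 <= b t) ->
  (forall t, b t + A - S - X t <= b t.+1) ->
  (forall t, G <= q * (A - S - X t) + z * (eps - S - X t) + V * C t) ->
  n%:R * G <= (q + z) * b n + V * \sum_(0 <= t < n) C t.
Proof.
move=> q0 z0 epsAS X0 b0 bS GX.
have backlog_ge : n%:R * (A - S) - \sum_(0 <= t < n) X t <= b n.
  elim: n => [|n IH]; first by rewrite mul0r big_geq // subr0.
  by rewrite big_nat_recr //= -natr1; have := bS n; lra.
have Xs0 : 0 <= \sum_(0 <= t < n) X t by exact: sumr_ge0.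
have virtual_ge : n%:R * (eps - S) - \sum_(0 <= t < n) X t <= b n.
  case/orP: epsAS => le_eps.
    apply: le_trans backlog_ge; rewrite lerD2r ler_wpM2l //; lra.
  by have := b0 n; have := ler0n R n; nra.
have : n%:R * G <= q * (n%:R * (A - S) - \sum_(0 <= t < n) X t) +
    z * (n%:R * (eps - S) - \sum_(0 <= t < n) X t) +
    V * \sum_(0 <= t < n) C t.
  clear Xs0 virtual_ge backlog_ge; elim: n => [|n IH].
    by rewrite !big_geq // !mul0r !subrr !mulr0 !addr0.
  by rewrite !big_nat_recr //= -natr1; have := GX n; lra.
by have := ler_wpM2l q0 backlog_ge; have := ler_wpM2l z0 virtual_ge; lra.
Qed.

End DriftBounds.

(** * Expectations of bounded random variables *)

Section BoundedIntegrals.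
Context {R : realType} {d : measure_display} {T : measurableType d}.
Variable P : probability T R.
Implicit Types f g : T -> R.

Lemma bounded_integrable f m M : measurable_fun setT f ->
  (forall w, m <= f w <= M) -> P.-integrable setT (EFin \o f).
Proof.
move=> mf fb; apply: measurable_bounded_integrable => //.
  by rewrite -ge0_fin_numE ?fin_num_measure.
exists (Num.max `|m| `|M|); split; first exact: num_real.
move=> r rM w _; apply: le_trans (ltW rM).
have /andP[mw wM] := fb w.
by rewrite le_max; case: (leP 0 (f w)) => f0; apply/orP;
  [right; rewrite ger0_norm // (le_trans wM) // ler_norm|
   left; rewrite ltr0_norm // ler_normr lerN2 mw orbT].
Qed.

Lemma expectation_Rintegral f : P.-integrable setT (EFin \o f) ->
  'E_P[f]%E = (\int[P]_w f w)%:E.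
Proof.
by move=> fi; rewrite unlock /Rintegral fineK //; exact: integrable_fin_num.
Qed.

Lemma Rintegral_le_cst f M : P.-integrable setT (EFin \o f) ->
  (forall w, f w <= M) -> \int[P]_w f w <= M.
Proof.
move=> fi fM; apply: (@le_trans _ _ (\int[P]_w (cst M w))).
  by apply: le_Rintegral => //; exact: finite_measure_integrable_cst.
by rewrite Rintegral_cst //= probability_setT mulr1.
Qed.

End BoundedIntegrals.

Section RealIntegrable.
Context {R : realType} {d : measure_display} {T : measurableType d}.
Variable P : probability T R.
Implicit Types f g : T -> R.

Lemma integrable_add f g : P.-integrable setT (EFin \o f) ->
  P.-integrable setT (EFin \o g) ->
  P.-integrable setT (EFin \o fun w => f w + g w).
Proof. exact: integrableD. Qed.

Lemma integrable_sub f g : P.-integrable setT (EFin \o f) ->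
  P.-integrable setT (EFin \o g) ->
  P.-integrable setT (EFin \o fun w => f w - g w).
Proof. exact: integrableB. Qed.

Lemma integrable_scale (k : R) f : P.-integrable setT (EFin \o f) ->
  P.-integrable setT (EFin \o fun w => k * f w).
Proof. exact: integrableZl. Qed.

Lemma integrable_const (k : R) : P.-integrable setT (EFin \o fun=> k).
Proof. exact: finite_measure_integrable_cst. Qed.

Lemma Rintegral_const (k : R) : \int[P]_w k = k.
Proof. by rewrite Rintegral_cst //= probability_setT mulr1. Qed.

Lemma time_average_Rintegral (X : nat -> T -> R) t :
  (forall i, P.-integrable setT (EFin \o X i)) ->
  time_average P X t = (t%:R^-1 * \sum_(0 <= i < t) \int[P]_w X i w)%:E.
Proof.
move=> Xi; rewrite /time_average EFinM -sumEFin; congr (_ * _)%E.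
by apply: eq_bigr => i _; exact: expectation_Rintegral.
Qed.

End RealIntegrable.

Ltac integrable_lin :=
  repeat first
    [ by []
    | exact: integrable_const
    | apply: integrable_sub
    | apply: integrable_add
    | apply: integrable_scale ].

(** * Integrals of independent and identically distributed variables *)

Section IndependentPair.
Context {R : realType} {d d1 d2 : measure_display} {T : measurableType d}.
Context {E1 : measurableType d1} {E2 : measurableType d2}.
Variable P : probability T R.
Variables (H : T -> E1) (X : T -> E2).
Hypothesis mH : measurable_fun setT H.
Hypothesis mX : measurable_fun setT X.
Hypothesis indep : forall A B, measurable A -> measurable B ->
  P (H @^-1` A `&` X @^-1` B) = (P (H @^-1` A) * P (X @^-1` B))%E.

(** By independence [(H w, X w)] has the same law under [P] as [(H v, X w)]
    under [P \x P], so by Fubini [H] can be frozen while [X] is integrated. *)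
Lemma independent_Rintegral_le (f : E1 * E2 -> R) m M K :
  measurable_fun setT f -> (forall v w, m <= f (H v, X w) <= M) ->
  (forall v, \int[P]_w f (H v, X w) <= K) -> \int[P]_w f (H w, X w) <= K.
Proof.
move=> mf fb fK.
pose HX w := (H w, X w); pose HX2 (vw : T * T) := (H vw.1, X vw.2).
have mHX : measurable_fun setT HX by exact: measurable_fun_pair.
have mHX2 : measurable_fun setT HX2.
  by apply: measurable_fun_pair; exact: measurableT_comp.
have fi : P.-integrable setT (EFin \o (f \o HX)).
  apply: (@bounded_integrable _ _ _ _ _ m M) => [|w]; last exact: fb.
  exact: measurableT_comp.
have fi2 : (P \x P)%E.-integrable setT (EFin \o (f \o HX2)).
  apply: (@bounded_integrable _ _ _ _ _ m M) => [|w]; last exact: fb.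
  exact: measurableT_comp.
have same_law : \int[P]_w f (HX w) = \int[(P \x P)%E]_w f (HX2 w).
  rewrite /Rintegral; congr fine.
  transitivity (\int[pushforward P HX]_z (f z)%:E)%E.
    by rewrite integral_pushforward //; exact/measurable_EFinP.
  transitivity (\int[pushforward (P \x P) HX2]_z (f z)%:E)%E; last first.
    by rewrite integral_pushforward //; exact/measurable_EFinP.
  apply: eq_measure_integral => A mA _.
  apply: (@measure_unique _ _ _
    [set A `*` B | A in d1.-measurable & B in d2.-measurable]
    (fun=> setT)) => //.
  - by rewrite measurable_prod_measurableType.
  - move=> _ _ [A1 mA1 [B1 mB1 <-]] [A2 mA2 [B2 mB2 <-]].
    exists (A1 `&` A2); first exact: measurableI.
    by exists (B1 `&` B2); [exact: measurableI|rewrite setXI].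
  - by move=> _; exists setT => //; exists setT => //; rewrite setXTT.
  - by rewrite bigcup_const.
  - move=> _ [A1 mA1 [B1 mB1 <-]].
    transitivity (P (H @^-1` A1) * P (X @^-1` B1))%E; first exact: indep.
    rewrite -product_measure1E //; rewrite -[X in measurable X]setTI.
      exact: mH.
    exact: mX.
  - by move=> _; exact: le_lt_trans (probability_le1 P measurableT) (ltry _).
rewrite (_ : \int[P]_w _ = \int[P]_w f (HX w)) // same_law.
rewrite /Rintegral -integral12_prod_meas1 //.
have fvi v : P.-integrable setT (EFin \o (fun w => f (H v, X w))).
  apply: (@bounded_integrable _ _ _ _ _ m M) => //.
  by apply: measurableT_comp => //; exact: measurable_fun_pair.
have FE : fubini_F P (EFin \o (f \o HX2)) =
    EFin \o fun v => \int[P]_w f (H v, X w).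
  apply/funext => v; rewrite /fubini_F /Rintegral /= fineK //.
  exact: integrable_fin_num (fvi v).
rewrite FE; apply: Rintegral_le_cst fK.
by rewrite -FE; exact: integrable_fubini_F.
Qed.

End IndependentPair.

Section Transfer.
Context {R : realType} {d d' : measure_display}.
Context {T : measurableType d} {U : measurableType d'}.
Variables (P : probability T R) (PU : probability U R).

Lemma eq_law_Rintegral (X Y : T -> U) (f : U -> R) m M :
  measurable_fun setT X -> measurable_fun setT Y -> measurable_fun setT f ->
  (forall A, measurable A -> P (X @^-1` A) = P (Y @^-1` A)) ->
  (forall w, m <= f (X w) <= M) -> (forall w, m <= f (Y w) <= M) ->
  \int[P]_w f (X w) = \int[P]_w f (Y w).
Proof.
move=> mX mY mf XY fX fY; rewrite /Rintegral; congr fine.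
transitivity (\int[pushforward P X]_z (f z)%:E)%E.
  rewrite integral_pushforward //; first exact/measurable_EFinP.
  apply: (@bounded_integrable _ _ _ P (f \o X) m M) => //.
  exact: measurableT_comp.
transitivity (\int[pushforward P Y]_z (f z)%:E)%E.
  by apply: eq_measure_integral => A mA _; exact: XY.
rewrite integral_pushforward //; first exact/measurable_EFinP.
apply: (@bounded_integrable _ _ _ P (f \o Y) m M) => //.
exact: measurableT_comp.
Qed.

Lemma Rintegral_fst (f : T -> R) m M : measurable_fun setT f ->
  (forall w, m <= f w <= M) ->
  \int[(P \x PU)%E]_w f w.1 = \int[P]_w f w.
Proof.
move=> mf fb.
have fi : (P \x PU)%E.-integrable setT (EFin \o (f \o fst)).
  apply: (@bounded_integrable _ _ _ _ _ m M) => [|w]; last exact: fb.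
  exact: measurableT_comp.
rewrite /Rintegral; congr fine.
transitivity (\int[P]_v fubini_F PU (EFin \o (f \o fst)) v)%E.
  by rewrite (integral12_prod_meas1 fi).
apply: eq_integral => w _; rewrite /fubini_F /=.
by rewrite integral_cst //= probability_setT mule1.
Qed.

End Transfer.

Section History.
Context {R : realType} {d d' : measure_display}.
Context {Omega : measurableType d} {E : measurableType d'}.
Variables (P : probability Omega R) (X : nat -> Omega -> E).

(** The events deciding each of [X 0, ..., X (t - 1)] separately.  They form
    a pi-system generating the sigma-algebra of the past of slot [t]. *)
Definition past_cylinders t : set (set Omega) :=
  [set G | exists2 A : nat -> set E, (forall i, measurable (A i)) &
     G = \bigcap_(i in [set` iota 0 t]) (X i @^-1` A i)].

Lemma measurable_past i t : (i < t)%N ->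
  measurable_fun (setT : set (g_sigma_algebraType (past_cylinders t))) (X i).
Proof.
move=> it _ A mA; rewrite setTI; apply: sub_sigma_algebra.
exists (fun j => if j == i then A else setT) => [j|].
  by case: eqP.
apply/seteqP; split => [w Aw j _ /=|w /(_ i)]; first by case: eqP => // ->.
by rewrite /= mem_iota it eqxx; apply.
Qed.

Hypothesis mX : forall t, measurable_fun setT (X t).
Hypothesis iidX : iid P X.

(** The definition of [iid] gives the product rule on cylinders.  For fixed
    [B], both sides are finite measures in [G], so by uniqueness of measures
    on a pi-system they agree on the whole past. *)
Lemma past_independent t (G : set Omega) (B : set E) :
  <<s past_cylinders t >> G -> measurable B ->
  P (G `&` X t @^-1` B) = (P G * P (X t @^-1` B))%E.
Proof.
move=> sG mB.
have mXB i A : measurable A -> measurable (X i @^-1` A).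
  by move=> mA; rewrite -[X in measurable X]setTI; exact: mX.
have rE : P (X t @^-1` B) = (fine (P (X t @^-1` B)))%:E.
  by rewrite fineK // fin_num_measure //; exact: mXB.
have r0 : 0 <= fine (P (X t @^-1` B)) by exact: fine_ge0.
have cylT : past_cylinders t setT.
  exists (fun=> setT) => //.
  by apply/seteqP; split.
transitivity (mrestr P (mXB t B mB) G) => //.
transitivity (mscale (NngNum r0) P G); last by rewrite /mscale /= -rE muleC.
apply: (g_sigma_algebra_measure_unique (past_cylinders t) _
  (fun=> setT)) sG => //.
- move=> _ [A mA ->]; apply: bigcap_measurableType => // i _; exact: mXB.
- by rewrite bigcup_const.
- move=> _ _ [A mA ->] [A' mA' ->].
  exists (fun i => A i `&` A' i) => [i|]; first exact: measurableI.
  by rewrite -bigcapI.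
- move=> _ [A mA ->]; set C0 := \bigcap_(i in _) _.
  change (P (C0 `&` X t @^-1` B) = ((fine (P (X t @^-1` B)))%:E * P C0)%E).
  rewrite -rE /C0 {C0}.
  (* The intersection with [X t @^-1` B] is again a cylinder, over the slots
     [0, ..., t]. *)
  pose C i := if i == t then B else A i.
  have CA i : i \in iota 0 t -> C i = A i.
    by rewrite mem_iota /C add0n => /= it; rewrite ltn_eqF.
  have [_ indep] := iidX.
  have := indep (t :: iota 0 t) C; rewrite big_cons /C eqxx -/C => indep_tC.
  have -> : \bigcap_(i in [set` iota 0 t]) (X i @^-1` A i) `&` X t @^-1` B =
      \bigcap_(i in [set` t :: iota 0 t]) (X i @^-1` C i).
    apply/seteqP; split => [w [Aw Bw] i /=|w Cw].
      rewrite in_cons => /predU1P[->|it]; first by rewrite /C eqxx.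
      by rewrite CA //; exact: Aw.
    split => [i it|].
      by have := Cw i; rewrite /= in_cons it orbT CA //; apply.
    by have := Cw t; rewrite /= in_cons eqxx /C eqxx; apply.
  rewrite indep_tC.
  - rewrite indep //; last exact: iota_uniq.
    congr (_ * _)%E; apply: eq_big_seq => i it.
    by have := CA i it; rewrite /C => ->.
  - by rewrite cons_uniq iota_uniq mem_iota add0n ltnn.
  - by move=> i; rewrite /C; case: eqP.
- move=> _; have mTB := measurableI _ _ measurableT (mXB t B mB).
  exact: le_lt_trans (probability_le1 P mTB) (ltry _).
Qed.

End History.

(** * Limits of time averages *)

Section Limits.
Variable R : realType.

Lemma limn_esup_lt (u : nat -> \bar R) x : (limn_esup u < x)%E ->
  exists y N, (y < x)%E /\ forall n, (N <= n)%N -> (u n <= y)%E.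
Proof.
move=> /ereal_inf_lt[_ [A [N _ NA] <-] supx].
exists (ereal_sup (u @` A)), N; split => // n Nn.
by apply: ereal_sup_ubound; exists n => //; exact: NA.
Qed.

(** If [k * n <= b n] for all large [n], then the terms between [n] and [2 n]
    alone make the average over [2 n] slots at least [k * n / 2], which is
    unbounded. *)
Lemma sublinear_frequently (b : nat -> R) k N : 0 < k ->
  (forall n, 0 <= b n) ->
  (limn_esup (fun n => (n%:R^-1 * \sum_(0 <= i < n) b i)%:E) < +oo)%E ->
  exists2 n, (N < n)%N & b n < k * n%:R.
Proof.
move=> k0 b0 /limn_esup_lt[y [N' [yoo avg_le]]].
have [M avgM] : exists M, forall n, (N' <= n)%N ->
    n%:R^-1 * \sum_(0 <= i < n) b i <= M.
  case: y yoo avg_le => [r|//|] _ avg_le.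
    by exists r => n /avg_le; rewrite lee_fin.
  by exists 0 => n /avg_le.
apply: contrapT => nex.
have bk n : (N < n)%N -> k * n%:R <= b n.
  by move=> Nn; rewrite leNgt; apply/negP => bn; apply: nex; exists n.
(* Beyond both thresholds, and large enough that [k * n / 2] exceeds [M]. *)
pose n := (N + N' + Num.bound (2 * `|M| / k)).+1.
have n0 : 0 < n%:R :> R by rewrite ltr0n.
have Mn : 2 * M < k * n%:R.
  have le_bound : 2 * M / k <= 2 * `|M| / k.
    by rewrite ler_pM2r ?invr_gt0 // ler_pM2l // ler_norm.
  rewrite [k * _]mulrC -ltr_pdivrMr //; apply: le_lt_trans le_bound _.
  apply: lt_le_trans (archi_boundP _) _.
    by rewrite divr_ge0 ?mulr_ge0 // ltW.
  by rewrite ler_nat /n leqW // leq_addl.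
have : n%:R * (k * n%:R) <= \sum_(0 <= i < n + n) b i.
  rewrite (@big_cat_nat _ _ _ n) ?leq_addr //=.
  apply: ler_wpDl; first by apply: sumr_ge0.
  apply: (@le_trans _ _ (\sum_(n <= i < n + n) (k * n%:R))).
    by rewrite big_const_nat addnK iter_addr addr0 mulr_natl.
  apply: ler_sum_nat => i /andP[ni _]; apply: le_trans (bk i _).
    by rewrite ler_pM2l // ler_nat.
  by apply: leq_trans ni; rewrite /n ltnS -addnA leq_addr.
have : (N' <= n + n)%N.
  rewrite /n; apply: leq_trans (leq_addr _ _).
  by rewrite ltnW // ltnS -addnA addnCA leq_addr.
move=> /avgM; rewrite ler_pdivrMl; last by rewrite ltr0n addn_gt0.
rewrite natrD; nra.
Qed.

(** Otherwise [C n <= r < G] for all large [n], and then [b] would grow at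
    least at a fixed linear rate. *)
Lemma le_lim_of_sublinear (b C : nat -> R) (G k : R) (c : \bar R) :
  0 <= k -> (forall n, 0 <= b n) ->
  (limn_esup (fun n => (n%:R^-1 * \sum_(0 <= i < n) b i)%:E) < +oo)%E ->
  (forall n, (0 < n)%N -> n%:R * G <= k * b n + n%:R * C n) ->
  (fun n => (C n)%:E) @ \oo --> c -> (G%:E <= c)%E.
Proof.
move=> k0 b0 bavg GC Cc; rewrite leNgt; apply/negP.
have [_ <-] := cvg_limn_einf_sup Cc.
move=> /limn_esup_lt[y [N [yG CN]]].
case: y yG CN => [r||] //; last by move=> _ /(_ _ (leqnn N)).
rewrite lte_fin => rG CN.
have k1 : 0 < k + 1 by lra.
have d0 : 0 < (G - r) / (k + 1) by rewrite divr_gt0 ?subr_gt0.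
have [n Nn bn] := sublinear_frequently N d0 b0 bavg.
have n0 : (0 < n)%N by exact: leq_ltn_trans Nn.
have := GC n n0; have := CN n (ltnW Nn); rewrite lee_fin => Cr.
have nR : 0 < n%:R :> R by rewrite ltr0n.
have : (k + 1) * b n < (G - r) * n%:R.
  by move: bn; rewrite mulrAC ltr_pdivlMr // mulrC.
have := b0 n; nra.
Qed.

End Limits.

(** * Measurability of the queues *)

Section Measurability.
Context {R : realType} {d : measure_display} {T : measurableType d}.

Lemma measurable_thresholded_purchase (Q Z gamma x : T -> R) (V x_max : R) :
  measurable_fun setT Q -> measurable_fun setT Z ->
  measurable_fun setT gamma ->
  (forall w, x w = if Q w + Z w <= V * gamma w then 0 else x_max) ->
  measurable_fun setT x.
Proof.
move=> mQ mZ mg /funext ->; apply: measurable_fun_ifT => //.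
apply: measurable_fun_ler; first exact: measurable_funD.
exact: measurable_funM.
Qed.

(** [T] may carry any sigma-algebra, and only the slots before [t] have to be
    measurable for it.  It is used for the events of the sample space and for
    the sigma-algebra of the past. *)
Lemma measurable_backlogs (s a gamma x Q Z : nat -> T -> R)
    (x_max eps V : R) t :
  (forall w, Q 0%N w = 0) -> (forall w, Z 0%N w = 0) ->
  (forall t w, x t w = if Q t w + Z t w <= V * gamma t w then 0 else x_max) ->
  (forall t w, Q t.+1 w = Num.max (Q t w - s t w - x t w) 0 + a t w) ->
  (forall t w, Z t.+1 w =
    Num.max (Z t w - s t w - x t w + (if 0 < Q t w then eps else 0)) 0) ->
  (forall i, (i < t)%N -> [/\ measurable_fun setT (s i),
     measurable_fun setT (a i) & measurable_fun setT (gamma i)]) ->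
  measurable_fun setT (Q t) /\ measurable_fun setT (Z t).
Proof.
move=> Q0 Z0 hx hQ hZ; elim: t => [|t IH] mE.
  by rewrite (funext Q0) (funext Z0); split.
have [mQ mZ] : measurable_fun setT (Q t) /\ measurable_fun setT (Z t).
  by apply: IH => i it; apply: mE; exact: ltnW.
have [ms ma mg] := mE t (ltnSn t).
have mx := measurable_thresholded_purchase mQ mZ mg (hx t).
rewrite (funext (hQ t)) (funext (hZ t)); split.
  apply: measurable_funD => //; apply: measurable_maxr => //.
  by apply: measurable_funB => //; exact: measurable_funB.
apply: measurable_maxr => //; apply: measurable_funD.
  by apply: measurable_funB => //; exact: measurable_funB.
by apply: measurable_fun_ifT => //; exact: measurable_fun_ltr.
Qed.

Lemma measurable_backlog (s a x : nat -> T -> R) t :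
  (forall i, measurable_fun setT (s i)) ->
  (forall i, measurable_fun setT (a i)) ->
  (forall i, measurable_fun setT (x i)) ->
  measurable_fun setT (fun w => backlog (s^~ w) (a^~ w) (x^~ w) t).
Proof.
move=> ms ma mx; elim: t => [|t IH] //=.
apply: measurable_funD => //; apply: measurable_maxr => //.
by apply: measurable_funB => //; exact: measurable_funB.
Qed.

Lemma measurable_drift_bound (eps V x_max : R) (q z s a g : T -> R) :
  measurable_fun setT q -> measurable_fun setT z -> measurable_fun setT s ->
  measurable_fun setT a -> measurable_fun setT g ->
  measurable_fun setT
    (fun w => drift_bound eps V x_max (q w) (z w) (s w) (a w) (g w)).
Proof.
move=> mq mz ms ma mg; rewrite /drift_bound.
apply: measurable_funD; last first.
  apply: measurable_minr => //; apply: measurable_funM => //.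
  apply: measurable_funB => //; apply: measurable_funB => //.
  exact: measurable_funM.
apply: measurable_funD; apply: measurable_funM => //; exact: measurable_funB.
Qed.

End Measurability.

(** * The cost of competitors and the cost of the threshold algorithm *)

Section CostComparison.
Variables (R : realType) (d : measure_display) (Omega : measurableType d).
Variables (P : probability Omega R) (s a gamma : nat -> {RV P >-> R}).
Variables (s_max a_max gamma_max x_max eps V : R).
Hypothesis hs : forall t w, 0 <= s t w <= s_max.
Hypothesis ha : forall t w, 0 <= a t w <= a_max.
Hypothesis hgamma : forall t w, 0 <= gamma t w <= gamma_max.
Hypothesis x_max0 : 0 <= x_max.
Hypothesis heps : 0 <= eps.
Hypothesis hV : 0 < V.
Hypothesis hiid : iid P (fun t w => (s t w, a t w, gamma t w)).
Hypothesis eps_le : (eps%:E <= maxe 'E_P[a 0%N] 'E_P[s 0%N])%E.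

Lemma measurable_slot t :
  measurable_fun setT (fun w => (s t w, a t w, gamma t w)).
Proof. by apply: measurable_fun_pair => //; exact: measurable_fun_pair. Qed.

Lemma slot_Rintegral (f : R * R * R -> R) m M t : measurable_fun setT f ->
  (forall i w, m <= f (s i w, a i w, gamma i w) <= M) ->
  \int[P]_w f (s t w, a t w, gamma t w) =
  \int[P]_w f (s 0%N w, a 0%N w, gamma 0%N w).
Proof.
move=> mf fb.
apply: (@eq_law_Rintegral _ _ _ _ _ P (fun w => (s t w, a t w, gamma t w))
  (fun w => (s 0%N w, a 0%N w, gamma 0%N w)) f m M) => //.
- exact: measurable_slot.
- exact: measurable_slot.
- by case: hiid => + _; apply.
Qed.

Lemma eps_le_means :
  (eps <= \int[P]_w a 0%N w) || (eps <= \int[P]_w s 0%N w).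
Proof.
have ai : P.-integrable setT (EFin \o a 0%N).
  by apply: (@bounded_integrable _ _ _ _ _ 0 a_max).
have si : P.-integrable setT (EFin \o s 0%N).
  by apply: (@bounded_integrable _ _ _ _ _ 0 s_max).
by move: eps_le; rewrite le_max !expectation_Rintegral // !lee_fin.
Qed.

(** The decision of a competitor on a slot may depend on the future and on
    its random seed; it still is a point of [0, x_max], which is all that the
    minimum in [drift_bound] asks for. *)
Lemma drift_bound_le_attainable q z c : 0 <= q -> 0 <= z ->
  attainable_costs P s a gamma x_max c ->
  (((\int[P]_w drift_bound eps V x_max q z (s 0%N w) (a 0%N w) (gamma 0%N w))%R
    / V)%:E <= c)%E.
Proof.
move=> q0 z0 [d' [U [PU [x [xb backlog_stable cost_cvg]]]]].
pose P' := (P \x PU)%E.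
pose bl t w := backlog (s^~ w.1) (a^~ w.1) (x^~ w) t.
have ms t : measurable_fun setT (fun w : Omega * U => s t w.1).
  exact: measurableT_comp.
have ma t : measurable_fun setT (fun w : Omega * U => a t w.1).
  exact: measurableT_comp.
have mg t : measurable_fun setT (fun w : Omega * U => gamma t w.1).
  exact: measurableT_comp.
have bl_bounds t w : 0 <= bl t w <= t%:R * a_max.
  rewrite /bl; elim: t => [|t IH] /=; first by rewrite mul0r lexx.
  have := hs t w.1; have := ha t w.1; have := xb t w.
  rewrite -natr1; move: IH; set y := backlog _ _ _ _.
  by case: (leP (y - s t w.1 - x t w) 0) => h; lra.
have bli t : P'.-integrable setT (EFin \o bl t).
  apply: bounded_integrable (bl_bounds t).
  exact: measurable_backlog.
have si t : P'.-integrable setT (EFin \o fun w => s t w.1).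
  by apply: (@bounded_integrable _ _ _ _ _ 0 s_max).
have ai t : P'.-integrable setT (EFin \o fun w => a t w.1).
  by apply: (@bounded_integrable _ _ _ _ _ 0 a_max).
have xi t : P'.-integrable setT (EFin \o x t).
  by apply: (@bounded_integrable _ _ _ _ _ 0 x_max).
have gxi t : P'.-integrable setT (EFin \o fun w => gamma t w.1 * x t w).
  apply: (@bounded_integrable _ _ _ _ _ 0 (gamma_max * x_max)) => [|w].
    exact: measurable_funM.
  exact: mulr_bounds.
have meanS t : \int[P']_w s t w.1 = \int[P]_w s 0%N w.
  rewrite (@Rintegral_fst _ _ _ _ _ P PU (s t) 0 s_max) //.
  apply: (@slot_Rintegral (fun p => p.1.1) 0 s_max) => //.
  exact: measurableT_comp.
have meanA t : \int[P']_w a t w.1 = \int[P]_w a 0%N w.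
  rewrite (@Rintegral_fst _ _ _ _ _ P PU (a t) 0 a_max) //.
  apply: (@slot_Rintegral (fun p => p.1.2) 0 a_max) => //.
  exact: measurableT_comp.
pose G := \int[P]_w
  drift_bound eps V x_max q z (s 0%N w) (a 0%N w) (gamma 0%N w).
have meanG t : \int[P']_w
    drift_bound eps V x_max q z (s t w.1) (a t w.1) (gamma t w.1) = G.
  pose m := - ((q + z) * (s_max + x_max)); pose M := q * a_max + z * eps.
  have db i w :
      m <= drift_bound eps V x_max q z (s i w) (a i w) (gamma i w) <= M.
    by apply: drift_bound_bounded (hgamma i w) => //; rewrite ?q0 ?z0 lexx.
  have mf : measurable_fun setT (fun p : R * R * R =>
      drift_bound eps V x_max q z p.1.1 p.1.2 p.2).
    by apply: measurable_drift_bound => //; exact: measurableT_comp.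
  rewrite (@Rintegral_fst _ _ _ _ _ P PU (fun w => drift_bound eps V x_max q z
    (s t w) (a t w) (gamma t w)) m M) //; last exact: measurable_drift_bound.
  exact: (@slot_Rintegral (fun p => drift_bound eps V x_max q z p.1.1 p.1.2 p.2)
    m M t mf).
pose A := \int[P]_w a 0%N w; pose S := \int[P]_w s 0%N w.
pose X t := \int[P']_w x t w; pose C t := \int[P']_w (gamma t w.1 * x t w).
pose b t := \int[P']_w bl t w.
have GX t : G <= q * (A - S - X t) + z * (eps - S - X t) + V * C t.
  have <- : \int[P']_w (q * (a t w.1 - s t w.1 - x t w) +
      z * (eps - s t w.1 - x t w) + V * (gamma t w.1 * x t w)) =
      q * (A - S - X t) + z * (eps - S - X t) + V * C t.
    rewrite /A /S -(meanA t) -(meanS t) /X /C.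
    by rewrite !(RintegralB, RintegralD, RintegralZl, Rintegral_const) //;
      integrable_lin.
  rewrite -(meanG t); apply: le_Rintegral => //; first last.
  - by move=> w _; exact: drift_bound_le.
  - by integrable_lin.
  pose m := - ((q + z) * (s_max + x_max)); pose M := q * a_max + z * eps.
  apply: (@bounded_integrable _ _ _ _ _ m M) => [|w].
    exact: measurable_drift_bound.
  by apply: drift_bound_bounded (hgamma t w.1) => //; rewrite ?q0 ?z0 lexx.
have b0 t : 0 <= b t by apply: Rintegral_ge0 => w _; case/andP: (bl_bounds t w).
have X0 t : 0 <= X t by apply: Rintegral_ge0 => w _; case/andP: (xb t w).
have bS t : b t + A - S - X t <= b t.+1.
  have <- : \int[P']_w (bl t w + a t w.1 - s t w.1 - x t w) =
      b t + A - S - X t.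
    rewrite /A /S -(meanA t) -(meanS t).
    by rewrite !(RintegralB, RintegralD) //; integrable_lin.
  apply: le_Rintegral => //; first by integrable_lin.
  move=> w _; rewrite /bl /=; set y := backlog _ _ _ _.
  by case: (leP (y - s t w.1 - x t w) 0) => h; lra.
have sum_bound n := competitor_sum_bound n q0 z0 eps_le_means X0 b0 bS GX.
apply: (@le_lim_of_sublinear _ b (fun n => n%:R^-1 * \sum_(0 <= t < n) C t)
  _ ((q + z) / V)) => //.
- by rewrite divr_ge0 ?addr_ge0 // ltW.
- move: backlog_stable; congr (limn_esup _ < _)%E; apply/funext => n.
  by rewrite time_average_Rintegral.
- move=> n n0; rewrite mulVKf ?pnatr_eq0 -?lt0n //.
  rewrite mulrA ler_pdivrMr // mulrDl mulrAC divfK ?gt_eqF //.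
  by rewrite [X in _ + X]mulrC.
- move: cost_cvg; congr (_ @ \oo --> c); apply/funext => n.
  by rewrite time_average_Rintegral.
Qed.

Variables (x Q Z : nat -> Omega -> R).
Hypothesis a_le_x : a_max <= x_max.
Hypothesis eps_le_x : eps <= x_max.
Hypothesis hQ0 : forall w, Q 0%N w = 0.
Hypothesis hZ0 : forall w, Z 0%N w = 0.
Hypothesis hx : forall t w,
  x t w = if Q t w + Z t w <= V * gamma t w then 0 else x_max.
Hypothesis hQ : forall t w,
  Q t.+1 w = Num.max (Q t w - s t w - x t w) 0 + a t w.
Hypothesis hZ : forall t w, Z t.+1 w =
  Num.max (Z t w - s t w - x t w + (if 0 < Q t w then eps else 0)) 0.

Let q_max := V * gamma_max + a_max.
Let z_max := V * gamma_max + eps.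

Lemma threshold_backlog_bounds t w :
  0 <= Q t w <= q_max /\ 0 <= Z t w <= z_max.
Proof.
have [-> ->] := backlogs_ge0 (fun i => ha i w) (hQ0 w) (hZ0 w)
  (fun i => hQ i w) (fun i => hZ i w) t.
have [-> ->] // := backlogs_bounded (fun i => hs i w) (fun i => ha i w)
  (fun i => hgamma i w) a_le_x eps_le_x heps hV (hQ0 w) (hZ0 w)
  (fun i => hx i w) (fun i => hQ i w) (fun i => hZ i w) t.
Qed.

Lemma threshold_backlogs_measurable t :
  measurable_fun setT (Q t) /\ measurable_fun setT (Z t).
Proof. by apply: measurable_backlogs hQ0 hZ0 hx hQ hZ _ => i _. Qed.

(** The queues are measurable for the past of slot [t], hence independent of
    the environment on that slot. *)
Lemma drift_bound_expectation_le t K :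
  (forall q z, 0 <= q -> 0 <= z ->
    \int[P]_w drift_bound eps V x_max q z (s 0%N w) (a 0%N w) (gamma 0%N w)
      <= K) ->
  \int[P]_w drift_bound eps V x_max (Q t w) (Z t w) (s t w) (a t w) (gamma t w)
    <= K.
Proof.
move=> GK.
pose X i w := (s i w, a i w, gamma i w); pose H w := (Q t w, Z t w).
have mX i : measurable_fun setT (X i) by exact: measurable_slot.
have [mQ mZ] := threshold_backlogs_measurable t.
have mH : measurable_fun setT H by exact: measurable_fun_pair.
pose past := g_sigma_algebraType (past_cylinders X t).
have mHpast : measurable_fun (setT : set past) (H : past -> _).
  have [] : measurable_fun (setT : set past) (Q t : past -> R) /\
            measurable_fun (setT : set past) (Z t : past -> R).
    apply: (@measurable_backlogs _ _ past s a gamma x Q Z) hQ0 hZ0 hx hQ hZ _.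
    move=> i it.
    have mXi : measurable_fun (setT : set past) (X i) by exact: measurable_past.
    split.
    - exact: (measurableT_comp (measurableT_comp measurable_fst measurable_fst)
        mXi).
    - exact: (measurableT_comp (measurableT_comp measurable_snd measurable_fst)
        mXi).
    - exact: (measurableT_comp measurable_snd mXi).
  exact: measurable_fun_pair.
pose f (p : (R * R) * (R * R * R)) :=
  drift_bound eps V x_max p.1.1 p.1.2 p.2.1.1 p.2.1.2 p.2.2.
have mf : measurable_fun setT f.
  apply: measurable_drift_bound.
  - exact: (measurableT_comp measurable_fst measurable_fst).
  - exact: (measurableT_comp measurable_snd measurable_fst).
  - exact: (measurableT_comp (measurableT_comp measurable_fst measurable_fst)
      measurable_snd).
  - exact: (measurableT_comp (measurableT_comp measurable_snd measurable_fst)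
      measurable_snd).
  - exact: (measurableT_comp measurable_snd measurable_snd).
pose m := - ((q_max + z_max) * (s_max + x_max)).
pose M := q_max * a_max + z_max * eps.
apply: (@independent_Rintegral_le _ _ _ _ _ _ _ P H (X t) mH (mX t) _ f m M
  _ mf).
- move=> A B mA mB; apply: past_independent => //.
  by have := mHpast measurableT A mA; rewrite setTI.
- move=> v w; have [Qb Zb] := threshold_backlog_bounds t v.
  exact: (drift_bound_bounded heps hV x_max0 Qb Zb (hs t w) (ha t w)
    (hgamma t w)).
- move=> v; have [Qb Zb] := threshold_backlog_bounds t v.
  have /andP[Q0 _] := Qb; have /andP[Z0 _] := Zb.
  apply: le_trans (GK _ _ Q0 Z0).
  rewrite (@slot_Rintegral (fun p => f (H v, p)) m M) // => [|i w].
    exact: (measurableT_comp mf (pair1_measurable (H v))).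
  exact: (drift_bound_bounded heps hV x_max0 Qb Zb (hs i w) (ha i w)
    (hgamma i w)).
Qed.

Lemma threshold_purchase_measurable t : measurable_fun setT (x t).
Proof.
have [mQ mZ] := threshold_backlogs_measurable t.
exact: measurable_thresholded_purchase mQ mZ _ (hx t).
Qed.

Lemma threshold_purchase_in t w : 0 <= x t w <= x_max.
Proof.
exact: threshold_purchase_bounds eps_le_x heps (fun i => hx i w) t.
Qed.

Lemma threshold_cost_integrable t :
  P.-integrable setT (EFin \o fun w => gamma t w * x t w).
Proof.
apply: (@bounded_integrable _ _ _ _ _ 0 (gamma_max * x_max)) => [|w].
  by apply: measurable_funM => //; exact: threshold_purchase_measurable.
by apply: mulr_bounds (threshold_purchase_in t w).
Qed.

(** Summing [drift_plus_penalty] over the slots, the Lyapunov function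
    telescopes; it starts at 0 and is nonnegative. *)
Lemma threshold_cost_le t K :
  (forall q z, 0 <= q -> 0 <= z ->
    \int[P]_w drift_bound eps V x_max q z (s 0%N w) (a 0%N w) (gamma 0%N w)
      <= K) ->
  V * \sum_(0 <= i < t) \int[P]_w (gamma i w * x i w) <=
  t%:R * (((s_max + x_max) ^+ 2 + a_max ^+ 2) / 2 +
          Num.max (eps ^+ 2) ((s_max + x_max) ^+ 2) / 2 + K).
Proof.
set B := _ / 2 + _ / 2 => GK.
pose L i w := (Q i w ^+ 2 + Z i w ^+ 2) / 2.
have Li i : P.-integrable setT (EFin \o L i).
  apply: (@bounded_integrable _ _ _ _ _ 0 ((q_max ^+ 2 + z_max ^+ 2) / 2)).
    have [mQ mZ] := threshold_backlogs_measurable i.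
    apply: measurable_funM => //.
    by apply: measurable_funD; exact: measurable_funX.
  move=> w; have [/andP[? ?] /andP[? ?]] := threshold_backlog_bounds i w.
  by rewrite /L !expr2; apply/andP; split; nra.
have di i : P.-integrable setT (EFin \o fun w =>
    drift_bound eps V x_max (Q i w) (Z i w) (s i w) (a i w) (gamma i w)).
  apply: (@bounded_integrable _ _ _ _ _
    (- ((q_max + z_max) * (s_max + x_max))) (q_max * a_max + z_max * eps)).
    have [mQ mZ] := threshold_backlogs_measurable i.
    exact: measurable_drift_bound.
  move=> w; have [Qb Zb] := threshold_backlog_bounds i w.
  exact: (drift_bound_bounded heps hV x_max0 Qb Zb (hs i w) (ha i w)
    (hgamma i w)).
have ci := threshold_cost_integrable.
have drift i : \int[P]_w L i.+1 w - \int[P]_w L i w +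
    V * \int[P]_w (gamma i w * x i w) <= B + K.
  apply: le_trans (lerD (lexx B) (drift_bound_expectation_le i GK)).
  rewrite -[X in _ <= X + _](Rintegral_const P).
  rewrite -RintegralB // -RintegralZl // -!RintegralD //; try by integrable_lin.
  apply: le_Rintegral => //; try by integrable_lin.
  move=> w _; have [/andP[Q0 _] /andP[Z0 _]] := threshold_backlog_bounds i w.
  exact: (drift_plus_penalty heps x_max0 Q0 Z0 (hs i w) (ha i w) (hx i w)
    (hQ i w) (hZ i w)).
have L0 : \int[P]_w L 0%N w = 0.
  rewrite /L; under eq_Rintegral do rewrite hQ0 hZ0 expr0n /= addr0 mul0r.
  exact: Rintegral_const.
suff : V * \sum_(0 <= i < t) \int[P]_w (gamma i w * x i w) +
    \int[P]_w L t w <= t%:R * (B + K).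
  have : 0 <= \int[P]_w L t w.
    apply: Rintegral_ge0 => w _.
    by rewrite /L divr_ge0 // addr_ge0 // sqr_ge0.
  lra.
elim: t => [|i IH]; first by rewrite big_geq // L0 mulr0 mul0r addr0.
by rewrite big_nat_recr //= -natr1; have := drift i; lra.
Qed.

End CostComparison.

Theorem theorem1 (R : realType) (d : measure_display) (Omega : measurableType d)
    (P : probability Omega R) (s a gamma : nat -> {RV P >-> R})
    (s_max a_max gamma_max x_max eps V : R) (x Q Z : nat -> Omega -> R)
    (hs : forall t w, 0 <= s t w <= s_max)
    (ha : forall t w, 0 <= a t w <= a_max)
    (hgamma : forall t w, 0 <= gamma t w <= gamma_max)
    (hx_max : Num.max a_max eps <= x_max)
    (heps : 0 <= eps) (hV : 0 < V)
    (hQ0 : forall w, Q 0%N w = 0) (hZ0 : forall w, Z 0%N w = 0)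
    (hx : forall t w,
       x t w = if Q t w + Z t w <= V * gamma t w then 0 else x_max)
    (hQ : forall t w,
       Q t.+1 w = Num.max (Q t w - s t w - x t w) 0 + a t w)
    (hZ : forall t w,
       Z t.+1 w =
         Num.max (Z t w - s t w - x t w + (if 0 < Q t w then eps else 0)) 0) :
  [/\ forall t w, Q t w <= V * gamma_max + a_max /\
                  Z t w <= V * gamma_max + eps,
      0 < eps -> forall t w,
        fulfilled_within (s^~ w) (x^~ w) (Q^~ w) t
          `|Num.ceil ((2 * V * gamma_max + a_max + eps) / eps)|%N &
      iid P (fun t w => (s t w, a t w, gamma t w)) ->
      (forall t, (eps%:E <= maxe 'E_P[a t] 'E_P[s t])%E) ->
      forall t, (0 < t)%N ->
        let B := ((s_max + x_max) ^+ 2 + a_max ^+ 2) / 2 +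
                 Num.max (eps ^+ 2) ((s_max + x_max) ^+ 2) / 2 in
        (time_average P (fun tau w =>
             (gamma tau w * actual_purchase (Q tau w) (s tau w) (x tau w))%R) t
           <= time_average P (fun tau w => (gamma tau w * x tau w)%R) t)%E /\
        (time_average P (fun tau w => (gamma tau w * x tau w)%R) t
           <= optimal_cost P s a gamma x_max + (B / V)%:E)%E].
Proof.
have [a_le_x eps_le_x] : a_max <= x_max /\ eps <= x_max.
  by move: hx_max; rewrite ge_max => /andP[].
have x_max0 : 0 <= x_max by exact: le_trans eps_le_x.
split.
- move=> t w.
  exact: (backlogs_bounded (fun i => hs i w) (fun i => ha i w)
    (fun i => hgamma i w) a_le_x eps_le_x heps hV (hQ0 w) (hZ0 w)
    (fun i => hx i w) (fun i => hQ i w) (fun i => hZ i w) t).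
- move=> eps0 t w.
  apply: (delay_bounded (fun i => hs i w) (fun i => ha i w)
    (fun i => hgamma i w) a_le_x eps_le_x heps hV (hQ0 w) (hZ0 w)
    (fun i => hx i w) (fun i => hQ i w) (fun i => hZ i w)).
  rewrite -ler_pdivrMr //.
  have -> : V * gamma_max + a_max + (V * gamma_max + eps) =
      2 * V * gamma_max + a_max + eps by ring.
  apply: le_trans (ceil_ge _) _.
  by rewrite -[X in _ <= X]/((Posz _)%:~R) ler_int abszE ler_norm.
move=> hiid eps_le t t0 B.
have x_in := threshold_purchase_in heps eps_le_x hx.
have cost_int i : P.-integrable setT (EFin \o fun w => gamma i w * x i w).
  exact: (@threshold_cost_integrable _ _ _ P s a gamma gamma_max x_max eps V
    hgamma heps x Q Z eps_le_x hQ0 hZ0 hx hQ hZ i).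
have actual_le i w :
    0 <= actual_purchase (Q i w) (s i w) (x i w) <= x i w.
  have /andP[x0 _] := x_in i w.
  rewrite /actual_purchase; case: ifPn => [_|]; first by rewrite x0 lexx.
  rewrite -ltNge => Qsx; rewrite le_max lexx orbT /= ge_max x0 andbT.
  exact: ltW.
have actual_int i : P.-integrable setT (EFin \o fun w =>
    gamma i w * actual_purchase (Q i w) (s i w) (x i w)).
  apply: (@bounded_integrable _ _ _ _ _ 0 (gamma_max * x_max)) => [|w].
    have [mQ mZ] := threshold_backlogs_measurable hQ0 hZ0 hx hQ hZ i.
    have mx := threshold_purchase_measurable hQ0 hZ0 hx hQ hZ i.
    have mQs : measurable_fun setT (fun w => Q i w - s i w).
      exact: measurable_funB.
    apply: measurable_funM => //; apply: measurable_fun_ifT => //.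
      exact: measurable_fun_ler.
    exact: measurable_maxr.
  apply: mulr_bounds => //; have /andP[-> /le_trans] := actual_le i w; apply.
  by case/andP: (x_in i w).
rewrite !time_average_Rintegral // lee_fin; split.
  rewrite ler_wpM2l ?invr_ge0 //; apply: ler_sum => i _.
  apply: le_Rintegral => // w _; have /andP[_ le_x] := actual_le i w.
  by rewrite ler_wpM2l //; case/andP: (hgamma i w).
rewrite -leeBlDr //; apply/ereal_infP => c c_att.
have G_le q z : 0 <= q -> 0 <= z -> _ := fun q0 z0 =>
  drift_bound_le_attainable hs ha hgamma x_max0 heps hV hiid (eps_le 0%N)
    q0 z0 c_att.
case: c c_att G_le => [r|_ _|_ /(_ 0 0 (lexx 0) (lexx 0))] //; last first.
  by rewrite leey.
move=> _ G_le; rewrite -EFinB lee_fin.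
have := threshold_cost_le hs ha hgamma x_max0 heps hV hiid
  a_le_x eps_le_x hQ0 hZ0 hx hQ hZ t.
move=> /(_ (V * r)); rewrite -/B => cost_le.
have {cost_le} : V * \sum_(0 <= i < t) \int[P]_w (gamma i w * x i w) <=
    t%:R * (B + V * r).
  apply: cost_le => q z q0 z0.
  by have := G_le q z q0 z0; rewrite lee_fin ler_pdivrMr // mulrC.
have tR : 0 < t%:R :> R by rewrite ltr0n.
rewrite lerBlDr ler_pdivrMl // -ler_pdivlMl // => /le_trans; apply.
by rewrite mulrCA mulrDr mulrA mulVf ?gt_eqF // mul1r addrC [V^-1 * _]mulrC.
Qed.
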